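(* The category $\mathsf{ISpace}$ of I-spaces and I-space morphisms is dually equivalent to the category $\mathsf{ISL}$ of implicative semilattices and implicative semilattice homomorphisms: $\mathsf{ISpace} \equiv^{\mathrm{op}} \mathsf{ISL}$.
   Context: A semilattice is a poset with finite meets ($\wedge$, top $\top$); it is implicative if there is a binary $\to$ with $x \leq y \to z$ iff $x \wedge y \leq z$. Implicative semilattice homomorphisms preserve $\top$, $\wedge$ and $\to$. A filter is a non-empty up-closed subset closed under finite meets. An M-space is $(X,\wedge,\top,\tau)$ with $(X,\wedge,\top)$ a meet-semilattice with top and $(X,\tau)$ a Stone space generated by a subbase of clopen filters and their complements. With the order $x \leq y$ iff $x \wedge y = x$, for filters $a,b$ put $a \Rightarrow b = \{x \mid \forall y \geq x,\ y \in a \Rightarrow y \in b\}$. An I-space is an M-space whose collection of clopen filters is closed under $\Rightarrow$. An I-space morphism is a continuous semilattice homomorphism $f$ (preserving finite meets and top) that is bounded: whenever $f(x) \leq y'$ there exists $y \geq x$ with $f(y) = y'$. *)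

(* Defs.v *)
From HB Require Import structures.
From mathcomp Require Import all_boot all_order.
From mathcomp Require Import boolp classical_sets cardinality filter.
(* Importing [topology] would bring in the ordered topological types, below
   which Hierarchy Builder refuses to insert topological semilattices. *)
From mathcomp Require Import topology_structure compact connected.
From mathcomp Require Import separation_axioms.

Set Implicit Arguments.
Unset Strict Implicit.
Unset Printing Implicit Defensive.

Import Order.TTheory.

Local Open Scope classical_set_scope.
Local Open Scope order_scope.

Record category := Category {
  obj :> Type;
  hom : obj -> obj -> Type;
  idm : forall a, hom a a;
  compm : forall a b c, hom b c -> hom a b -> hom a c;
  compm_idl : forall a b (f : hom a b), compm (idm b) f = f;
  compm_idr : forall a b (f : hom a b), compm f (idm a) = f;
  compmA : forall a b c e (h : hom c e) (g : hom b c) (f : hom a b),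
    compm h (compm g f) = compm (compm h g) f }.

Arguments hom {_} a b.
Arguments idm {_} a.
Arguments compm {_ a b _} g f.

Definition opposite (C : category) : category :=
  @Category C (fun a b => @hom C b a) (fun a => idm a)
    (fun _ _ _ g f => compm f g)
    (fun _ _ f => compm_idr f) (fun _ _ f => compm_idl f)
    (fun _ _ _ _ h g f => esym (compmA f g h)).

Record functor (C D : category) := Functor {
  fobj :> C -> D;
  fhom : forall a b : C, hom a b -> hom (fobj a) (fobj b);
  fhom_id : forall a : C, fhom (idm a) = idm (fobj a);
  fhom_comp : forall (a b c : C) (g : hom b c) (f : hom a b),
    fhom (compm g f) = compm (fhom g) (fhom f) }.

Arguments fhom {C D} F {a b} f : rename.

Definition functor_id (C : category) : functor C C :=
  @Functor C C id (fun _ _ f => f) (fun _ => erefl) (fun _ _ _ _ _ => erefl).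

Section functor_comp.
Variables (C D E : category) (G : functor D E) (F : functor C D).

Definition functor_comp_hom (a b : C) (f : hom a b) : hom (G (F a)) (G (F b)) :=
  fhom G (fhom F f).

Lemma functor_comp_id a : functor_comp_hom (idm a) = idm (G (F a)).
Proof. by rewrite /functor_comp_hom !fhom_id. Qed.

Lemma functor_comp_comp (a b c : C) (g : hom b c) (f : hom a b) :
  functor_comp_hom (compm g f) = compm (functor_comp_hom g) (functor_comp_hom f).
Proof. by rewrite /functor_comp_hom !fhom_comp. Qed.

Definition functor_comp : functor C E :=
  Functor functor_comp_id functor_comp_comp.

End functor_comp.

Definition isomorphism (C : category) (a b : C) (f : hom a b) :=
  exists g : hom b a, compm g f = idm a /\ compm f g = idm b.

Definition naturally_isomorphic (C D : category) (F G : functor C D) :=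
  exists t : forall a : C, hom (F a) (G a),
    (forall (a b : C) (f : hom a b),
       compm (fhom G f) (t a) = compm (t b) (fhom F f)) /\
    (forall a, isomorphism (t a)).

Definition equivalent (C D : category) :=
  exists (F : functor C D) (G : functor D C),
    naturally_isomorphic (functor_comp G F) (functor_id C) /\
    naturally_isomorphic (functor_comp F G) (functor_id D).

Definition dually_equivalent (C D : category) := equivalent (opposite C) D.

HB.mixin Record TMeetSemilattice_hasImp d (T : Type)
    of Order.TMeetSemilattice d T := {
  imp : T -> T -> T;
  lexImp : forall x y z : T, (x <= imp y z) = (x `&` y <= z) }.

#[short(type="implicativeSemilatticeType")]
HB.structure Definition ImplicativeSemilattice d :=
  { T of Order.TMeetSemilattice d T & TMeetSemilattice_hasImp d T }.

Definition semilattice_hom d d' (S : tMeetSemilatticeType d)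
    (T : tMeetSemilatticeType d') (f : S -> T) :=
  f \top = \top /\ {morph f : x y / x `&` y}.

Definition implicative_hom d d' (S : implicativeSemilatticeType d)
    (T : implicativeSemilatticeType d') (f : S -> T) :=
  semilattice_hom f /\ {morph f : x y / imp x y}.

Definition stone_space (T : topologicalType) :=
  [/\ compact [set: T], hausdorff_space T & totally_disconnected [set: T]].

(* [finI_from S id] is the family of finite intersections of members of [S],
   the empty intersection being the whole space. *)
Definition subbase (T : topologicalType) (S : set (set T)) :=
  basis (finI_from S id).

(* Filters of a semilattice; they need not be proper, and are not to be
   confused with the filters of sets of the library. *)
Definition semilattice_filter d (T : tMeetSemilatticeType d) (a : set T) :=
  [/\ a !=set0,
      forall x y, x <= y -> a x -> a y &
      forall x y, a x -> a y -> a (x `&` y)].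

Definition filter_imp d (T : porderType d) (a b : set T) : set T :=
  [set x | forall y, x <= y -> a y -> b y].

#[short(type="topologicalTMeetSemilatticeType")]
HB.structure Definition TopologicalTMeetSemilattice d :=
  { T of Topological T & Order.TMeetSemilattice d T }.

Definition clopen_filter d (T : topologicalTMeetSemilatticeType d)
    (a : set T) :=
  clopen a /\ semilattice_filter a.

HB.mixin Record isMSpace d T of TopologicalTMeetSemilattice d T := {
  mspace_stone : stone_space T;
  mspace_subbase : exists2 S : set (set T),
    S `<=` @clopen_filter d T & subbase (S `|` setC @` S) }.

#[short(type="mspaceType")]
HB.structure Definition MSpace d :=
  { T of TopologicalTMeetSemilattice d T & isMSpace d T }.

HB.mixin Record MSpace_isISpace d T of MSpace d T := {
  clopen_filter_imp : forall a b : set T,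
    @clopen_filter d T a -> @clopen_filter d T b ->
    @clopen_filter d T (filter_imp a b) }.

#[short(type="ispaceType")]
HB.structure Definition ISpace d :=
  { T of MSpace d T & MSpace_isISpace d T }.

Definition bounded_map d d' (S : porderType d) (T : porderType d')
    (f : S -> T) :=
  forall x y', f x <= y' -> exists2 y, x <= y & f y = y'.

Definition ispace_morphism d d' (X : ispaceType d) (Y : ispaceType d')
    (f : X -> Y) :=
  [/\ continuous f, semilattice_hom f & bounded_map f].

Section isl_category.
Variable d : Order.disp_t.
Implicit Types S T U : implicativeSemilatticeType d.

Definition isl_hom S T := {f : S -> T | implicative_hom f}.

Lemma implicative_hom_id S : implicative_hom (@id S).
Proof. by []. Qed.

Lemma implicative_hom_comp S T U (g : T -> U) (f : S -> T) :
  implicative_hom g -> implicative_hom f -> implicative_hom (g \o f).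
Proof.
move=> [[gT gI] gi] [[fT fI] fi]; split; last by move=> x y /=; rewrite fi gi.
by split=> [|x y] /=; rewrite ?fT ?gT ?fI ?gI.
Qed.

Definition isl_id S : isl_hom S S := exist _ _ (implicative_hom_id S).

Definition isl_comp S T U (g : isl_hom T U) (f : isl_hom S T) : isl_hom S U :=
  exist _ _ (implicative_hom_comp (svalP g) (svalP f)).

Lemma isl_comp_idl A B (f : isl_hom A B) :
  isl_comp (isl_id B) f = f.
Proof. by case: f => f hf; exact: eq_exist. Qed.

Lemma isl_comp_idr A B (f : isl_hom A B) :
  isl_comp f (isl_id A) = f.
Proof. by case: f => f hf; exact: eq_exist. Qed.

Lemma isl_compA A B C D (h : isl_hom C D) (g : isl_hom B C)
    (f : isl_hom A B) :
  isl_comp h (isl_comp g f) = isl_comp (isl_comp h g) f.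
Proof. exact: eq_exist. Qed.

Definition ISLCat : category :=
  Category isl_comp_idl isl_comp_idr isl_compA.

End isl_category.

Section ispace_category.
Variable d : Order.disp_t.
Implicit Types X Y Z : ispaceType d.

Definition ispace_hom X Y := {f : X -> Y | ispace_morphism f}.

Lemma ispace_morphism_id X : ispace_morphism (@id X).
Proof. by split=> [x|//|x y ?]; [exact: cvg_id|exists y]. Qed.

Lemma ispace_morphism_comp X Y Z (g : Y -> Z) (f : X -> Y) :
  ispace_morphism g -> ispace_morphism f -> ispace_morphism (g \o f).
Proof.
move=> [gc [gT gI] gb] [fc [fT fI] fb]; split.
- by move=> x; apply: continuous_comp; [exact: fc|exact: gc].
- by split=> [|x y] /=; rewrite ?fT ?gT ?fI ?gI.
- by move=> x z /gb[y /fb[x' xx' <-] <-]; exists x'.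
Qed.

Definition ispace_id X : ispace_hom X X := exist _ _ (ispace_morphism_id X).

Definition ispace_comp X Y Z (g : ispace_hom Y Z) (f : ispace_hom X Y) :
  ispace_hom X Z := exist _ _ (ispace_morphism_comp (svalP g) (svalP f)).

Lemma ispace_comp_idl A B (f : ispace_hom A B) :
  ispace_comp (ispace_id B) f = f.
Proof. by case: f => f hf; exact: eq_exist. Qed.

Lemma ispace_comp_idr A B (f : ispace_hom A B) :
  ispace_comp f (ispace_id A) = f.
Proof. by case: f => f hf; exact: eq_exist. Qed.

Lemma ispace_compA A B C D (h : ispace_hom C D) (g : ispace_hom B C)
    (f : ispace_hom A B) :
  ispace_comp h (ispace_comp g f) = ispace_comp (ispace_comp h g) f.
Proof. exact: eq_exist. Qed.

Definition ISpaceCat : category :=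
  Category ispace_comp_idl ispace_comp_idr ispace_compA.

End ispace_category.

(* Main.v *)
(* An I-space X is sent to the implicative semilattice of its clopen filters,
   an implicative semilattice A to the space of all its filters (A itself
   included), topologized by the sets {F | x \in F} and their complements; on
   morphisms both functors take preimages.
   On the algebraic side, x |-> {F | x \in F} is onto the clopen filters,
   because a clopen filter of the space of filters of A has a least member,
   which is a principal filter.
   On the topological side, x |-> {a | x \in a} is onto the filters of clopen
   filters by compactness of X: if a is not included in any of the filters
   b_1, ..., b_n, the meet of one witness for each b_i is in a and in no b_i. *)
Require Import Defs.
From mathcomp Require Import all_boot all_order.
From HB Require Import structures.
From mathcomp Require Import boolp classical_sets filter.
From mathcomp Require Import topology_structure compact.
From mathcomp Require Import separation_axioms.

Set Implicit Arguments.
Unset Strict Implicit.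
Unset Printing Implicit Defensive.

Import Order.TTheory.

Local Open Scope order_scope.
Local Open Scope classical_set_scope.

(** The inverses of the components, picked by choice, are again natural: compose the naturality
    square of [t] with the inverse on each side. *)
Lemma naturally_isomorphic_sym (C D : category) (F G : functor C D) :
  naturally_isomorphic F G -> naturally_isomorphic G F.
Proof.
move=> [t [tN tI]].
pose s a := sval (cid (tI a)).
have sP a : compm (s a) (t a) = idm (F a) /\ compm (t a) (s a) = idm (G a).
  exact: svalP (cid (tI a)).
exists s; split=> [a b f|a]; last by exists (t a); have [] := sP a.
rewrite -[LHS]compm_idl -(sP b).1 -compmA [compm (t b) _]compmA -tN -compmA.
by rewrite (sP a).2 compm_idr.
Qed.

(** * Filters of a meet-semilattice *)

Section semilattice_filter.
Context d (T : tMeetSemilatticeType d).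
Implicit Types a b : set T.

Lemma semilattice_filterT a : semilattice_filter a -> a \top.
Proof. by move=> [[x ax] aU _]; exact: aU (lex1 x) ax. Qed.

Lemma semilattice_filter_setT : @semilattice_filter d T setT.
Proof. by split=> //; exists \top. Qed.

Lemma semilattice_filterI a b : semilattice_filter a ->
  semilattice_filter b -> semilattice_filter (a `&` b).
Proof.
move=> af bf; have [[_ aU aI] [_ bU bI]] := (af, bf); split.
- by exists \top; split; exact: semilattice_filterT.
- by move=> x y xy [ax bx]; split; [exact: aU xy ax|exact: bU xy bx].
- by move=> x y [ax bx] [ay hby]; split; [exact: aI|exact: bI].
Qed.

Lemma semilattice_filter_meet a x y : semilattice_filter a ->
  a (x `&` y)%O = (a x /\ a y).
Proof.
move=> [_ aU aI]; apply/propext; split=> [axy|[]]; last exact: aI.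
by split; apply: aU axy; rewrite ?leIl ?leIr.
Qed.

Lemma semilattice_filter_principal (x : T) :
  semilattice_filter [set y | x <= y].
Proof.
split; first by exists x => /=.
- by move=> y z yz /= xy; exact: le_trans yz.
- by move=> y z /= xy xz; rewrite lexI xy.
Qed.

(* Take the meet of one element of [a] outside [f i] for each [i] in [l]. *)
Lemma semilattice_filter_avoid a (I : eqType) (f : I -> set T) (l : seq I) :
  semilattice_filter a ->
  (forall i x y, x <= y -> f i x -> f i y) ->
  (forall i, i \in l -> ~ a `<=` f i) ->
  exists2 x, a x & forall i, i \in l -> ~ f i x.
Proof.
move=> af fU; elim: l => [|i l IH] afi.
  by exists \top => //; exact: semilattice_filterT.
have [|x ax xl] := IH.
  by move=> j jl; apply: afi; rewrite inE jl orbT.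
have /existsNP[y /not_implyP[ay fy]] := afi i (mem_head _ _).
exists (x `&` y)%O; first by rewrite semilattice_filter_meet.
move=> j; rewrite inE => /predU1P[->|/xl fx].
  by move/(fU _ _ _ (leIr y x)).
by move/(fU _ _ _ (leIl x y)).
Qed.

End semilattice_filter.

(** * Homomorphisms, preimages of filters and inverses of bijective homomorphisms *)

Lemma semilattice_hom_le d d' (S : tMeetSemilatticeType d)
    (T : tMeetSemilatticeType d') (f : S -> T) :
  semilattice_hom f -> {homo f : x y / x <= y}.
Proof. by move=> [_ fI] x y; rewrite !leEmeet -fI => /eqP ->. Qed.

Lemma semilattice_filter_preimage d d' (S : tMeetSemilatticeType d)
    (T : tMeetSemilatticeType d') (f : S -> T) (a : set T) :
  semilattice_hom f -> semilattice_filter a -> semilattice_filter (f @^-1` a).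
Proof.
move=> fh af; have [[fT fI] [_ aU aI]] := (fh, af); split.
- by exists \top; rewrite /preimage /= fT; exact: semilattice_filterT.
- by move=> x y /(semilattice_hom_le fh); exact: aU.
- by move=> x y; rewrite /preimage /= fI; exact: aI.
Qed.

Section bijective_hom.
Context d d' (S : tMeetSemilatticeType d) (T : tMeetSemilatticeType d').
Variables (f : S -> T) (g : T -> S).
Hypotheses (fK : cancel f g) (gK : cancel g f) (fh : semilattice_hom f).

Lemma semilattice_hom_inverse : semilattice_hom g.
Proof.
have [fT fI] := fh; split; first by rewrite -fT fK.
by move=> x y; apply: (can_inj fK); rewrite fI !gK.
Qed.

(** The inverse is a homomorphism, hence monotone, so [f x <= y] gives [x <= g y]. *)
Lemma bounded_map_bijective : bounded_map f.
Proof.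
move=> x y xy; exists (g y); last exact: gK.
by rewrite -[x]fK; exact: semilattice_hom_le semilattice_hom_inverse _ _ xy.
Qed.

End bijective_hom.

Lemma implicative_hom_inverse d d' (S : implicativeSemilatticeType d)
    (T : implicativeSemilatticeType d') (f : S -> T) (g : T -> S) :
  cancel f g -> cancel g f -> implicative_hom f -> implicative_hom g.
Proof.
move=> fK gK [fh fi]; split; first exact: semilattice_hom_inverse fK gK fh.
by move=> x y; apply: (can_inj fK); rewrite fi !gK.
Qed.

(** * Semilattices of subsets under inclusion, for filters and clopen filters alike *)

Definition intersection_system T :=
  {P : set (set T) | P setT /\ setI_closed P}.

(* The display [d] is that of the order to be put on the members of [P]. *)
Definition members (d : Order.disp_t) T (P : intersection_system T) : Type :=
  {a : set T | sval P a}.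

Section members.
Variables (d : Order.disp_t) (T : Type) (P : intersection_system T).
Local Notation M := (members d P).

HB.instance Definition _ := gen_eqMixin M.
HB.instance Definition _ := gen_choiceMixin M.

Lemma members_inj (u v : M) : sval u = sval v -> u = v.
Proof. by case: u v => [a Pa] [b Pb] /= ab; exact: eq_exist. Qed.

Definition members_le (u v : M) := `[< sval u `<=` sval v >].

Lemma members_le_refl : reflexive members_le.
Proof. by move=> u; exact/asboolP. Qed.

Lemma members_le_anti : antisymmetric members_le.
Proof.
by move=> u v /andP[/asboolP uv /asboolP vu]; exact/members_inj/seteqP.
Qed.

Lemma members_le_trans : transitive members_le.
Proof.
by move=> v u w /asboolP uv /asboolP vw; apply/asboolP; exact: subset_trans vw.
Qed.

HB.instance Definition _ := Order.Le_isPOrder.Build d M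
  members_le_refl members_le_anti members_le_trans.

Definition members_meet (u v : M) : M :=
  exist _ (sval u `&` sval v) ((svalP P).2 _ _ (svalP u) (svalP v)).

Lemma members_lexI (u v w : M) :
  (u <= members_meet v w) = (u <= v) && (u <= w).
Proof.
apply/asboolP/andP => [|[/asboolP uv /asboolP uw]]; last by rewrite subsetI.
by rewrite /= subsetI => -[uv uw]; split; exact/asboolP.
Qed.

HB.instance Definition _ :=
  Order.POrder_isMeetSemilattice.Build d M members_lexI.

Definition members_top : M := exist _ setT (svalP P).1.

Lemma members_lex1 (u : M) : u <= members_top.
Proof. exact/asboolP. Qed.

HB.instance Definition _ := Order.hasTop.Build d M members_lex1.

Lemma members_leP (u v : M) : reflect (sval u `<=` sval v) (u <= v).
Proof. exact: asboolP. Qed.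

End members.

(** * Convergence, continuity and separation tested on a subbase *)

Section subbase.
Context (T : topologicalType) (S : set (set T)).
Hypothesis Ssub : subbase S.

Lemma subbase_open s : S s -> open s.
Proof. by move=> Ss; apply: Ssub.1; exact: (@finI_from1 _ _ S id). Qed.

Lemma subbase_cvg (F : set_system T) (x : T) : Filter F ->
  (forall s, S s -> s x -> F s) -> F --> x.
Proof.
move=> FF FS U /(Ssub.2 x)[_ [[D DS <-] Dx] DU].
apply: filterS DU _; apply: filter_bigI => s sD; apply: FS; last exact: Dx.
by have /set_mem := DS _ sD.
Qed.

Lemma subbase_continuous (X : topologicalType) (f : X -> T) :
  (forall s, S s -> open (f @^-1` s)) -> continuous f.
Proof.
move=> fS x; apply: subbase_cvg => s /fS so sx.
exact: open_nbhs_nbhs.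
Qed.

(** A one-sided implication suffices: it makes the neighbourhoods of [y] converge to [x], so every
    neighbourhood of [x] meets every neighbourhood of [y]. *)
Lemma subbase_separates (x y : T) : hausdorff_space T ->
  (forall s, S s -> s x -> s y) -> x = y.
Proof.
move=> Th xy; apply: Th => A B Ax By.
have : nbhs y --> x.
  apply: subbase_cvg => s Ss sx; apply: open_nbhs_nbhs; split.
    exact: subbase_open.
  exact: xy.
move=> /(_ A Ax) Ay; exact: (filter_ex (filterI Ay By)).
Qed.

End subbase.

Lemma zero_dimensional_hausdorff (T : topologicalType) :
  zero_dimensional T -> hausdorff_space T.
Proof.
rewrite open_hausdorff => T0 x y /T0[U [[oU cU] Ux Uy]].
exists (U, ~` U); first by split; exact/mem_set.
by split=> //=; [exact: closed_openC|rewrite setICr].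
Qed.

(** * The M-space of filters of a semilattice *)

Lemma intersection_system_filters d (A : tMeetSemilatticeType d) :
  @semilattice_filter d A setT /\ setI_closed (@semilattice_filter d A).
Proof.
by split; [exact: semilattice_filter_setT|exact: semilattice_filterI].
Qed.

Definition filters (d : Order.disp_t) d' (A : tMeetSemilatticeType d') : Type :=
  members d (exist _ _ (intersection_system_filters A)).

HB.instance Definition _ d d' (A : tMeetSemilatticeType d') :=
  Order.TMeetSemilattice.on (filters d A).

Section filter_space.
Variables (d d' : Order.disp_t) (A : tMeetSemilatticeType d').
Implicit Types (F G : filters d A) (x y : A) (l : seq A).

Lemma filters_filter F : semilattice_filter (sval F).
Proof. exact: svalP F. Qed.

Definition filters_with x : set (filters d A) := [set F | sval F x].

Definition filters_avoiding l : set (filters d A) :=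
  [set F | forall y, y \in l -> ~ sval F y].

Definition principal_filter x : filters d A :=
  exist _ _ (semilattice_filter_principal x).

Lemma filters_withI x y :
  filters_with (x `&` y)%O = filters_with x `&` filters_with y.
Proof.
apply/funext => F; exact: semilattice_filter_meet (filters_filter F).
Qed.

Lemma filters_withT : filters_with \top = setT.
Proof.
by apply/seteqP; split=> // F _; exact: semilattice_filterT (filters_filter F).
Qed.

Lemma filters_avoiding_cons x l :
  filters_avoiding (x :: l) = ~` filters_with x `&` filters_avoiding l.
Proof.
apply/seteqP; split=> F /= => [Fxl|[Fx Fl] y].
  split; first exact: Fxl (mem_head _ _).
  by move=> y yl; apply: Fxl; rewrite inE yl orbT.
by rewrite inE => /predU1P[->|/Fl].
Qed.

Lemma filters_avoiding_nil : filters_avoiding [::] = setT.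
Proof. exact/seteqP. Qed.

Lemma filters_avoiding_cat l l' :
  filters_avoiding (l ++ l') = filters_avoiding l `&` filters_avoiding l'.
Proof.
elim: l => [|x l IH]; first by rewrite filters_avoiding_nil setTI.
by rewrite /= !filters_avoiding_cons IH setIA.
Qed.

Lemma semilattice_filter_filters_with x :
  @semilattice_filter d (filters d A) (filters_with x).
Proof.
split; first by exists \top.
- by move=> F G /members_leP; exact.
- by move=> F G Fx Gx; split.
Qed.

(* Thanks to [filters_withI], one positive condition suffices to describe the
   basic open sets of the topology generated by the sets [filters_with x] and
   their complements. *)
Definition filters_open (U : set (filters d A)) :=
  forall F, U F -> exists x l, [/\ filters_with x F, filters_avoiding l F &
    filters_with x `&` filters_avoiding l `<=` U].

Lemma filters_openT : filters_open setT.
Proof.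
by move=> F _; exists \top, [::]; split=> //; rewrite filters_withT.
Qed.

Lemma filters_openI : setI_closed filters_open.
Proof.
move=> U V Uo Vo F [/Uo[x [l [Fx Fl xlU]]] /Vo[y [m [Fy Fm ymV]]]].
exists (x `&` y)%O, (l ++ m); rewrite filters_withI filters_avoiding_cat.
split=> // G [[Gx Gy] [Gl Gm]]; split; [exact: xlU|exact: ymV].
Qed.

Lemma filters_open_bigU (I : Type) (f : I -> set (filters d A)) :
  (forall i, filters_open (f i)) -> filters_open (\bigcup_i f i).
Proof.
move=> fo F [i _ /fo[x [l [Fx Fl xlf]]]]; exists x, l; split=> // G /xlf fG.
by exists i.
Qed.

HB.instance Definition _ := isOpenTopological.Build (filters d A)
  filters_openT filters_openI filters_open_bigU.

Lemma open_filtersE (U : set (filters d A)) : open U = filters_open U.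
Proof. by []. Qed.

Lemma filters_with_clopen x : clopen (filters_with x).
Proof.
split.
  rewrite open_filtersE => F Fx; exists x, [::].
  by rewrite filters_avoiding_nil setIT; split.
rewrite -openC open_filtersE => F Fx; exists \top, [:: x].
rewrite filters_avoiding_cons filters_avoiding_nil setIT filters_withT setTI.
by split.
Qed.

Lemma clopen_filter_filters_with x :
  @clopen_filter d (filters d A) (filters_with x).
Proof.
split; first exact: filters_with_clopen.
exact: semilattice_filter_filters_with.
Qed.

Lemma nbhs_filtersP F (U : set (filters d A)) : nbhs F U ->
  exists x l, [/\ filters_with x F, filters_avoiding l F &
    filters_with x `&` filters_avoiding l `<=` U].
Proof.
rewrite nbhsE => -[V [+ VF] VU]; rewrite open_filtersE => Vo.
have [x [l [Fx Fl xlV]]] := Vo F VF.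
by exists x, l; split=> //; exact: subset_trans VU.
Qed.

Lemma filters_subbase :
  subbase (range filters_with `|` setC @` range filters_with).
Proof.
set S := _ `|` _.
have So s : S s -> open s.
  move=> [[x _ <-]|[_ [x _ <-] <-]]; first exact: (filters_with_clopen x).1.
  by rewrite openC; exact: (filters_with_clopen x).2.
have S1 s : S s -> finI_from S id s := @finI_from1 _ _ S id s.
split=> [_ [D DS <-]|F U /nbhs_filtersP[x [l [Fx Fl xlU]]]].
  rewrite openE => F DF; apply: filter_bigI => s sD; apply: open_nbhs_nbhs.
  by split; [exact/So/set_mem/DS|exact: DF].
exists (filters_with x `&` filters_avoiding l); last exact: xlU.
split; last by split.
apply: finI_fromI; first by apply: S1; left; exists x.
elim: (l) => [|y m IH].
  (* With no negative condition left, the whole space is the subbasic set [filters_with \top]. *)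
  by rewrite filters_avoiding_nil -filters_withT; apply: S1; left; exists \top.
rewrite filters_avoiding_cons; apply: finI_fromI => //.
by apply: S1; right; exists (filters_with y) => //; exists y.
Qed.

(** An ultrafilter [W] converges to the filter of those [x] for which [filters_with x] is in [W].
    Positive conditions on this limit are in [W] by definition, and negative ones because [W]
    contains each set or its complement. *)
Lemma filters_compact : compact [set: filters d A].
Proof.
rewrite compact_ultra => /= W WU _.
have Lf : semilattice_filter [set x | W (filters_with x)].
  split; first by exists \top => /=; rewrite filters_withT; exact: filterT.
  - move=> x y xy; apply: filterS => F; have [_ FU _] := filters_filter F.
    exact: FU.
  - by move=> x y Wx Wy; rewrite /= filters_withI; exact: filterI.
exists (exist _ _ Lf); split=> // U /nbhs_filtersP[x [l [Wx Wl xlU]]].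
apply: filterS xlU _; apply: filterI => //.
elim: l Wl => [|y l IH].
  by rewrite filters_avoiding_nil => _; exact: filterT.
rewrite !filters_avoiding_cons => -[Wy /IH Wl]; apply: filterI => //.
by have [//|] := in_ultra_setVsetC (filters_with y) WU.
Qed.

Lemma filters_zero_dimensional : zero_dimensional (filters d A).
Proof.
move=> F G FG; apply: contrapT => nU; move/eqP: FG; apply; apply: members_inj.
apply/seteqP; split=> x Hx; apply: contrapT => nx; apply: nU.
  by exists (filters_with x); split=> //; exact: filters_with_clopen.
exists (~` filters_with x); split=> //.
exact: clopenC set0 (filters_with_clopen x).
Qed.

Lemma filters_stone : stone_space (filters d A).
Proof.
split; first exact: filters_compact.
- exact/zero_dimensional_hausdorff/filters_zero_dimensional.
- exact/zero_dimension_totally_disconnected/filters_zero_dimensional.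
Qed.

Lemma filters_mspace_subbase : exists2 S : set (set (filters d A)),
  S `<=` @clopen_filter d (filters d A) & subbase (S `|` setC @` S).
Proof.
exists (range filters_with); last exact: filters_subbase.
by move=> _ [x _ <-]; exact: clopen_filter_filters_with.
Qed.

HB.instance Definition _ := isMSpace.Build d (filters d A)
  filters_stone filters_mspace_subbase.

(** Principal filters suffice as tests: the one of [x] contains [y] exactly when [x <= y]. *)
Lemma filters_with_inj : injective filters_with.
Proof.
move=> x y xy; apply/le_anti/andP; split.
  by have : filters_with y (principal_filter x) by rewrite -xy /filters_with /=.
by have : filters_with x (principal_filter y) by rewrite xy /filters_with /=.
Qed.

(* The intersection [F0] of the members of [U] lies in [U] since [U] is closed;
   since [U] is open, it then contains a principal filter below [F0]. *)
Lemma clopen_filter_filtersP (U : set (filters d A)) : clopen_filter U ->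
  exists x, U = filters_with x.
Proof.
move=> [[Uo Uc] Uf]; have [_ UU _] := Uf.
have F0f : semilattice_filter [set x | U `<=` filters_with x].
  split.
  - by exists \top => F _; exact: semilattice_filterT (filters_filter F).
  - by move=> x y xy Ux F /Ux; have [_ FU _] := filters_filter F; exact: FU.
  - by move=> x y Ux Uy; rewrite /= filters_withI subsetI.
pose F0 : filters d A := exist _ _ F0f.
have UF0 : U F0.
  apply: contrapT => nU.
  have : filters_open (~` U) by rewrite -open_filtersE openC.
  move=> /(_ F0 nU)[x [l [F0x F0l xlU]]].
  (* By [F0l], [U] is included in no [filters_with y] with [y] in [l], so some [F] in [U] avoids all
     of [l]. It contains [x] by [F0x], so [xlU] puts it outside [U]. *)
  have [|F UF Fl] := semilattice_filter_avoid Uf _ F0l.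
    by move=> y F G /members_leP FG; exact: FG.
  by apply: (xlU F) => //; split=> //; exact: F0x.
have /(_ F0 UF0)[x [l [F0x F0l xlU]]] : filters_open U by [].
exists x; apply/seteqP; split=> F; first exact: F0x.
move=> Fx; apply: (UU (principal_filter x)).
  apply/members_leP => y /= xy; have [_ FU _] := filters_filter F.
  exact: FU Fx.
apply: xlU; split; first exact: lexx.
move=> y yl /= xy; apply: (F0l y yl); have [_ FU _] := F0f; exact: FU F0x.
Qed.

End filter_space.

Arguments filters_with d {d' A} x.

(** * Joins of filters, and implication between clopen filters of the filter space *)

Section filter_join.
Context d d' (S : tMeetSemilatticeType d) (T : tMeetSemilatticeType d').
Variables (h : S -> T) (a : set T) (b : set S).
Hypotheses (hh : semilattice_hom h).
Hypotheses (af : semilattice_filter a) (bf : semilattice_filter b).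

(** This is the filter generated by [a] and the image of [b] under [h]. The identity as [h] serves
    to compute implications, a general [h] to show that taking preimages along [h] is bounded. *)
Definition filter_join : set T :=
  [set z | exists x y, [/\ a x, b y & (x `&` h y)%O <= z]].

Lemma semilattice_filter_join : semilattice_filter filter_join.
Proof.
split.
- exists \top, \top, \top.
  by split; [exact: semilattice_filterT|exact: semilattice_filterT|exact: lex1].
- move=> z z' zz' [x [y [ax yb xyz]]]; exists x, y; split=> //.
  exact: le_trans zz'.
- move=> z z' [x [y [ax yb xyz]]] [x' [y' [ax' yb' xyz']]].
  exists (x `&` x')%O, (y `&` y')%O.
  split; rewrite ?semilattice_filter_meet //.
  by rewrite hh.2 meetACA leI2.
Qed.

Lemma filter_join_subl : a `<=` filter_join.
Proof.
by move=> x ax; exists x, \top; rewrite hh.1 meetx1; split=> //;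
  exact: semilattice_filterT.
Qed.

Lemma filter_join_subr : b `<=` h @^-1` filter_join.
Proof.
by move=> y yb; exists \top, y; rewrite meet1x; split=> //;
  exact: semilattice_filterT.
Qed.

End filter_join.

Section filters_of_implicative.
Variables (d d' : Order.disp_t) (A : implicativeSemilatticeType d').
Implicit Types x y : A.

(** Left to right is modus ponens inside the larger filter. Conversely, the hypothesis is applied to
    the filter generated by [F] and [x]: it contains [y], so some [z] in [F] has its meet with [x]
    below [y], that is, [z <= imp x y]. *)
Lemma filters_with_imp x y : filters_with d (imp x y) =
  filter_imp (filters_with d x) (filters_with d y).
Proof.
apply/seteqP; split=> F /=.
  move=> Fxy G /members_leP FG Gx; have [_ GU GI] := filters_filter G.
  by apply: GU (GI _ _ (FG _ Fxy) Gx); rewrite -lexImp.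
move=> Fxy; have Ff := filters_filter F.
have xf := semilattice_filter_principal x.
have idh : semilattice_hom (@id A) by [].
have Jf := semilattice_filter_join idh Ff xf.
have [||z [t [Fz /= xt ztxy]]] := Fxy (exist _ _ Jf).
- by apply/members_leP; exact: (filter_join_subl idh xf).
- exact: (@filter_join_subr _ _ _ _ id _ _ Ff x (lexx x)).
have [_ FU _] := Ff; apply: FU Fz; rewrite lexImp.
by apply: le_trans ztxy; rewrite leI2.
Qed.

Lemma filters_clopen_filter_imp (U V : set (filters d A)) :
  clopen_filter U -> clopen_filter V -> clopen_filter (filter_imp U V).
Proof.
move=> /clopen_filter_filtersP[x ->] /clopen_filter_filtersP[y ->].
rewrite -filters_with_imp; exact: clopen_filter_filters_with.
Qed.

HB.instance Definition _ := MSpace_isISpace.Build d (filters d A)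
  filters_clopen_filter_imp.

End filters_of_implicative.

(** * The implicative semilattice of clopen filters of an I-space *)

Lemma intersection_system_clopen_filters d
    (X : topologicalTMeetSemilatticeType d) :
  @clopen_filter d X setT /\ setI_closed (@clopen_filter d X).
Proof.
split=> [|a b [ac af] [bc bf]].
  by split; [exact: clopenT|exact: semilattice_filter_setT].
by split; [exact: clopenI|exact: semilattice_filterI].
Qed.

Definition clopen_filters (d : Order.disp_t) d'
    (X : topologicalTMeetSemilatticeType d') : Type :=
  members d (exist _ _ (intersection_system_clopen_filters X)).

HB.instance Definition _ d d' (X : topologicalTMeetSemilatticeType d') :=
  Order.TMeetSemilattice.on (clopen_filters d X).

Section clopen_filters_imp.
Variables (d d' : Order.disp_t) (X : ispaceType d').
Implicit Types u v w : clopen_filters d X.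

Lemma clopen_filtersP u : clopen_filter (sval u).
Proof. exact: svalP u. Qed.

Definition clopen_filters_imp u v : clopen_filters d X :=
  exist _ _ (clopen_filter_imp _ _ (clopen_filtersP u) (clopen_filtersP v)).

Lemma clopen_filters_lexImp u v w :
  (u <= clopen_filters_imp v w) = (u `&` v <= w)%O.
Proof.
apply/members_leP/members_leP => [uvw x [/uvw]|uvw x ux y xy vy]; first exact.
by apply: uvw; split=> //; have [_ [_ uU _]] := clopen_filtersP u; exact: uU ux.
Qed.

HB.instance Definition _ := TMeetSemilattice_hasImp.Build d
  (clopen_filters d X) clopen_filters_lexImp.

End clopen_filters_imp.

(** Monotonicity gives the inclusion from left to right. For the other, boundedness lifts each point
    above [f x] to a point above [x]; this is how bounded maps induce implicative homomorphisms. *)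
Lemma filter_imp_preimage d d' (S : porderType d) (T : porderType d')
    (f : S -> T) (a b : set T) : {homo f : x y / x <= y} -> bounded_map f ->
  f @^-1` filter_imp a b = filter_imp (f @^-1` a) (f @^-1` b).
Proof.
move=> fle fb; apply/seteqP; split=> x ab y; first by move=> /fle; exact: ab.
by move=> /fb[z xz <-]; exact: ab.
Qed.

(** * Preimage maps on clopen filters and on filters *)

Section clopen_filters_map.
Variables (d d' : Order.disp_t) (X Y : ispaceType d').
Variable f : ispace_hom X Y.

Lemma clopen_filter_preimage (a : set Y) :
  clopen_filter a -> clopen_filter (sval f @^-1` a).
Proof.
have [fc fh _] := svalP f; move=> [ac af].
by split; [exact: preimage_clopen|exact: semilattice_filter_preimage].
Qed.

Definition clopen_filters_map (u : clopen_filters d Y) : clopen_filters d X :=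
  exist _ _ (clopen_filter_preimage (clopen_filtersP u)).

Lemma clopen_filters_map_hom : implicative_hom clopen_filters_map.
Proof.
have [_ fh fb] := svalP f.
split; first by split=> [|u v]; exact: members_inj.
move=> u v; apply: members_inj; apply: filter_imp_preimage => //.
exact: semilattice_hom_le.
Qed.

End clopen_filters_map.

Section filters_map.
Variables (d d' : Order.disp_t) (A B : implicativeSemilatticeType d').
Variable h : isl_hom A B.

Definition filters_map (F : filters d B) : filters d A :=
  exist _ _ (semilattice_filter_preimage (svalP h).1 (filters_filter F)).

Lemma filters_map_morphism : ispace_morphism filters_map.
Proof.
have [hh hi] := svalP h; split.
- have hE x :
    filters_map @^-1` filters_with d x = filters_with d (sval h x) by [].
  have ho x := filters_with_clopen d (sval h x).
  apply: (subbase_continuous (filters_subbase d A)).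
  move=> _ [[x _ <-]|[_ [x _ <-] <-]].
    by rewrite hE; exact: (ho x).1.
  by rewrite -preimage_setC hE openC; exact: (ho x).2.
- by split=> [|F G]; exact: members_inj.
- move=> F G /members_leP FG.
  have [Ff Gf] := (filters_filter F, filters_filter G).
  (* The filter above [F] with preimage [G] is the one generated by [F] and the image of [G]. *)
  exists (exist _ _ (semilattice_filter_join hh Ff Gf)).
    by apply/members_leP; exact: (filter_join_subl hh Gf).
  apply: members_inj; apply/seteqP; split=> x.
    (* Here preservation of [imp] is essential: [z] lies below the image of [imp y x], so [imp y x]
       is in the preimage of [F], hence in [G], and [x] follows from [y] by modus ponens. *)
    move=> [z [y [Fz Gy]]]; rewrite -lexImp -hi => zyx.
    have [[_ FU _] [_ GU GI]] := (Ff, Gf).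
    apply: GU (GI _ _ (FG (imp y x) (FU _ _ zyx Fz)) Gy).
    by rewrite -lexImp.
  exact: filter_join_subr Ff x.
Qed.

End filters_map.

(** * An I-space is isomorphic to the space of filters of its clopen filters *)

Section point_filter.
Variables (d d' : Order.disp_t) (X : ispaceType d).
Implicit Types (x y : X) (u v : clopen_filters d' X).

Lemma semilattice_filter_point x :
  @semilattice_filter d' (clopen_filters d' X) [set u | sval u x].
Proof.
split; first by exists \top.
- by move=> u v /members_leP uv; exact: uv.
- by move=> u v ux vx; split.
Qed.

Definition point_filter x : filters d (clopen_filters d' X) :=
  exist _ _ (semilattice_filter_point x).

Lemma point_filter_hom : semilattice_hom point_filter.
Proof.
split=> [|x y]; apply: members_inj; apply/funext => u /=; apply/propext.
  by split=> // _; have [_ uf] := clopen_filtersP u; exact: semilattice_filterT.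
have [_ uf] := clopen_filtersP u.
by rewrite /= semilattice_filter_meet.
Qed.

(** Points in the same clopen filters agree on a subbase of a Hausdorff space. *)
Lemma point_filter_inj : injective point_filter.
Proof.
move=> x y /(congr1 sval) /= xy.
have xyE (a : set X) : clopen_filter a -> a x = a y.
  by move=> ac; have := congr1 (@^~ (exist _ a ac)) xy.
have [S Sclopen Ssub] := @mspace_subbase d X.
have [_ hX _] := @mspace_stone d X.
apply: (subbase_separates Ssub hX) => s [/Sclopen/xyE->//|].
by move=> [t /Sclopen/xyE tE <-] /=; rewrite tE.
Qed.

(** The point is a cluster point of the filter based on the sets [B (u, l)], with [u] in [F] and no
    member of [l] in [F]. It lies in every member of [F] because these are closed, and in no other
    clopen filter because those are open. *)
Lemma point_filter_surj (F : filters d (clopen_filters d' X)) :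
  exists x, point_filter x = F.
Proof.
have Ff := filters_filter F; have [cX _ _] := @mspace_stone d X.
pose D := [set i : clopen_filters d' X * seq (clopen_filters d' X) |
  sval F i.1 /\ forall u, u \in i.2 -> ~ sval F u].
pose B (i : clopen_filters d' X * seq (clopen_filters d' X)) : set X :=
   sval i.1 `&` [set x | forall u, u \in i.2 -> ~ sval u x].
have Dfilter : Filter (filter_from D B).
  apply: filter_from_filter; first by exists (\top, [::]); split=> //=;
    exact: semilattice_filterT.
  move=> [u l] [v m] [/= Fu Fl] [/= Fv Fm]; exists ((u `&` v)%O, l ++ m).
    split=> /=; first by rewrite semilattice_filter_meet.
    by move=> w; rewrite mem_cat => /orP[/Fl|/Fm].
  move=> x [/= [ux vx] lmx]; split; split=> //= w wl; apply: lmx.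
    by rewrite mem_cat wl.
  by rewrite mem_cat wl orbT.
have Dproper : ProperFilter (filter_from D B).
  apply: filter_from_proper => -[u l] [/= Fu Fl].
  have [_ uf] := clopen_filtersP u.
  (* Base sets are non-empty: [u] is included in no [v] of [l], since otherwise [v] would be in
     [F]. *)
  have [|v vl uv|x ux xl] :=
    @semilattice_filter_avoid _ _ (sval u) _ (fun v => sval v) l uf.
  - by move=> v; have [_ [_ vU _]] := clopen_filtersP v.
  - have [_ FU _] := Ff; apply: (Fl v vl); apply: FU Fu; exact/members_leP.
  - by exists x.
have [|x [_ Fx]] := cX (filter_from D B) Dproper.
  exact: filterT.
exists x; apply: members_inj; apply/seteqP; split=> u /=.
  move=> ux; apply: contrapT => nu; have [[uo _] _] := clopen_filtersP u.
  (* The complement of [u] contains the base set of [(\top, [:: u])], so the open neighbourhood [u]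
     of [x] would have to meet it. *)
  have [||y []] := Fx (~` sval u) (sval u).
  - exists (\top, [:: u]).
      split=> /=; first exact: semilattice_filterT.
      by move=> v; rewrite inE => /eqP ->.
    by move=> y [_ /= ny]; apply: ny; rewrite inE.
  - exact: open_nbhs_nbhs.
  - by [].
move=> Fu; have [[_ uc] _] := clopen_filtersP u.
(* As [u] contains the base set of [(u, [::])], the cluster point is in the closure of [u]. *)
apply: uc => V Vx; apply: Fx Vx.
by exists (u, [::]) => [|y []].
Qed.

Lemma point_filter_bijective :
  exists2 g, cancel point_filter g & cancel g point_filter.
Proof.
exists (fun F => sval (cid (point_filter_surj F))) => [x|F].
  by apply: point_filter_inj; case: cid.
by case: cid.
Qed.

Lemma point_filter_continuous : continuous point_filter.
Proof.
apply: (subbase_continuous (filters_subbase d (clopen_filters d' X))).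
have pE u : point_filter @^-1` filters_with d u = sval u by [].
move=> _ [[u _ <-]|[_ [u _ <-] <-]]; have [[uo uc] _] := clopen_filtersP u.
  by rewrite pE.
by rewrite -preimage_setC pE openC.
Qed.

(** Pulling a clopen filter of [X] back along [g] gives the set of filters that contain it, which is
    clopen. *)
Lemma point_filter_inverse_continuous g :
  cancel point_filter g -> cancel g point_filter -> continuous g.
Proof.
move=> pK gK; have [S Sclopen Ssub] := @mspace_subbase d X.
have gE (a : set X) (ac : clopen_filter a) :
    g @^-1` a = filters_with d (exist _ a ac : clopen_filters d' X).
  by apply/funext => F; rewrite -[F in RHS]gK.
apply: (subbase_continuous Ssub) => s [/Sclopen sc|[t /Sclopen tc <-]].
  by rewrite gE; exact: (filters_with_clopen _ _).1.
by rewrite -preimage_setC gE openC; exact: (filters_with_clopen _ _).2.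
Qed.

Lemma point_filter_morphism : ispace_morphism point_filter.
Proof.
have [g pK gK] := point_filter_bijective.
split; [exact: point_filter_continuous|exact: point_filter_hom|].
exact: bounded_map_bijective pK gK point_filter_hom.
Qed.

Lemma point_filter_isomorphism : @isomorphism (ISpaceCat d) X
  (filters d (clopen_filters d' X)) (exist _ _ point_filter_morphism).
Proof.
have [g pK gK] := point_filter_bijective.
have gh := semilattice_hom_inverse pK gK point_filter_hom.
have gm : ispace_morphism g.
  split=> //; first exact: point_filter_inverse_continuous.
  exact: bounded_map_bijective gK pK gh.
exists (exist _ g gm).
by split; apply: eq_exist; apply/funext => x /=; [exact: pK|exact: gK].
Qed.

End point_filter.

(** * An implicative semilattice is isomorphic to the clopen filters of its filter space *)

Section filters_with_isomorphism.
Variables (d d' : Order.disp_t) (A : implicativeSemilatticeType d').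

Definition clopen_filters_with (x : A) : clopen_filters d' (filters d A) :=
  exist _ _ (clopen_filter_filters_with d x).

Lemma clopen_filters_with_hom : implicative_hom clopen_filters_with.
Proof.
split; first split=> [|x y].
- by apply: members_inj; exact: filters_withT.
- by apply: members_inj; exact: filters_withI.
- by move=> x y; apply: members_inj; exact: filters_with_imp.
Qed.

Lemma clopen_filters_with_bijective :
  exists2 g, cancel clopen_filters_with g & cancel g clopen_filters_with.
Proof.
have ex u : exists x, clopen_filters_with x = u.
  have [x ux] := clopen_filter_filtersP (clopen_filtersP u).
  by exists x; exact: members_inj.
exists (fun u => sval (cid (ex u))) => [x|u]; last by case: cid.
by case: cid => y /= /(congr1 sval); exact: filters_with_inj.
Qed.

End filters_with_isomorphism.

(** * The two functors and the equivalence *)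

Section duality.
Variables d d' : Order.disp_t.

(** In the opposite category [f] is an I-space morphism from [Y] to [X], so preimages act
    covariantly. *)
Definition clopen_filters_hom (X Y : opposite (ISpaceCat d)) (f : hom X Y) :
    isl_hom (clopen_filters d' X) (clopen_filters d' Y) :=
  exist _ _ (clopen_filters_map_hom d' f).

Lemma clopen_filters_hom_id (X : opposite (ISpaceCat d)) :
  clopen_filters_hom (idm X) = isl_id (clopen_filters d' X).
Proof. by apply: eq_exist; apply/funext => u; exact: members_inj. Qed.

Lemma clopen_filters_hom_comp (X Y Z : opposite (ISpaceCat d)) (g : hom Y Z)
    (f : hom X Y) : clopen_filters_hom (compm g f) =
  isl_comp (clopen_filters_hom g) (clopen_filters_hom f).
Proof. by apply: eq_exist; apply/funext => u; exact: members_inj. Qed.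

Definition clopen_filters_functor :
    functor (opposite (ISpaceCat d)) (ISLCat d') :=
  @Functor (opposite (ISpaceCat d)) (ISLCat d')
    (fun X => clopen_filters d' X : ISLCat d') clopen_filters_hom
    clopen_filters_hom_id clopen_filters_hom_comp.

Definition filters_hom (A B : ISLCat d') (h : hom A B) :
    ispace_hom (filters d B) (filters d A) :=
  exist _ _ (filters_map_morphism d h).

Lemma filters_hom_id (A : ISLCat d') :
  filters_hom (idm A) = ispace_id (filters d A).
Proof. by apply: eq_exist; apply/funext => F; exact: members_inj. Qed.

Lemma filters_hom_comp (A B C : ISLCat d') (g : hom B C) (f : hom A B) :
  filters_hom (compm g f) = ispace_comp (filters_hom f) (filters_hom g).
Proof. by apply: eq_exist; apply/funext => F; exact: members_inj. Qed.

Definition filters_functor : functor (ISLCat d') (opposite (ISpaceCat d)) :=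
  @Functor (ISLCat d') (opposite (ISpaceCat d))
    (fun A => filters d A : ISpaceCat d) filters_hom
    filters_hom_id filters_hom_comp.

End duality.

Theorem theorem3p8 (d d' : Order.disp_t) :
  dually_equivalent (ISpaceCat d) (ISLCat d').
Proof.
exists (clopen_filters_functor d d'), (filters_functor d d'); split.
  (* A component towards [X] in the opposite category is an I-space morphism out of [X], which is
     the direction of [point_filter]. *)
  exists (fun X => exist _ _ (point_filter_morphism d' X)).
  split=> [X Y f|X].
    by apply: eq_exist; apply/funext => y; exact: members_inj.
  have [g [gp pg]] := point_filter_isomorphism d' X.
  by exists g; split.
(* [clopen_filters_with] starts at [A], while the definition of equivalence asks for components
   ending there. *)
apply: naturally_isomorphic_sym.
exists (fun A => exist _ _ (clopen_filters_with_hom d A)); split=> [A B f|A].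
  by apply: eq_exist; apply/funext => x; exact: members_inj.
have [g cK gK] := @clopen_filters_with_bijective d d' A.
have ch := clopen_filters_with_hom d A.
exists (exist _ g (implicative_hom_inverse cK gK ch)).
by split; apply: eq_exist; apply/funext => x /=; [exact: cK|exact: gK].
Qed.
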